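(* In HoTT, H-Replacement implies $[\![\chi]\!]_V$ for every instance $\chi$ of the Replacement scheme. Here: (H-Replacement) for every $r:V\to V$ and $x:V$ there merely exists $w:V$ such that for all $y:V$, $y\in w\iff\exists(z:V).(z\in x\wedge y=r(z))$; (Replacement scheme) for every formula $\phi(x,y)$ of set theory with two free variables, the instance is $$\forall S\bigl(\forall x\,\exists!y\,\phi(x,y)\Rightarrow\exists w\,\forall v\,(v\in w\iff\exists u\in S\;\phi(u,v))\bigr).$$
   Context: Work in HoTT: Martin-Löf type theory with the univalence axiom and higher inductive types, with universes $U:U'$. $\mathrm{isProp}(P):\equiv\prod_{x,y:P}x=y$, $\mathrm{Prop}_{U'}:\equiv\sum_{P:U'}\mathrm{isProp}(P)$. The symbols $\exists,\vee$ denote the propositional truncations of $\Sigma,+$, and ''merely exists'' refers to truncated existence. The cumulative hierarchy $V:U'$ is the higher inductive type with constructors: $\mathsf{set}:\prod_{A:U}(A\to V)\to V$; for all $A,B:U$, $f:A\to V$, $g:B\to V$, a path $\mathsf{set}(A,f)=\mathsf{set}(B,g)$ whenever $(\forall(a:A).\exists(b:B).f(a)=g(b))\wedge(\forall(b:B).\exists(a:A).f(a)=g(b))$; and a $0$-truncation constructor (so $V$ is an h-set). Membership is defined by $x\in\mathsf{set}(A,f):\equiv\exists(a:A).x=f(a)$, a proposition in $U'$. Formulas $\phi$ of the first-order language $\{\in\}$ of set theory are translated into predicates $[\![\phi]\!]_V:V^k\to\mathrm{Prop}_{U'}$ ($k$ the number of free variables) by induction: $x=y$ as the identity type of $V$,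 $x\in y$ as membership above, $\neg\phi$ as $\phi\to\mathbf 0$, $\to,\wedge,\vee$ as the corresponding operations on propositions ($\vee$ truncated), $\exists x$ and $\forall x$ as the truncated $\exists(x:V)$ and $\prod_{x:V}$. *)

(* Defs.v *)
From Stdlib Require Import FunctionalExtensionality.
Set Warnings "-stdlib-vector".
From Stdlib Require Import Fin.

Set Implicit Arguments.
Unset Strict Implicit.

(* Rocq's equality types are not stratified by universe level ([eq] lands in
   [Prop], whatever the type), so univalence is not assumed of Rocq's own
   universes.  Instead, as in two-level type theory, Rocq is the outer level:
   [Ty] is the collection of the types of HoTT and [El A] that of the elements
   of [A]; dependence on a variable is expressed by Rocq functions; Rocq's [=]
   stands for judgmental equality, and [Id] is the identity type of HoTT. *)

Class MLTT := {
  Ty : Type;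
  El : Ty -> Type;

  (* [lev i A] is the judgment A : U_i; the universes are cumulative.  The
     elements of [Univ i] correspond to the types A such that [lev i A]. *)
  lev : nat -> Ty -> Prop;
  lev_cumul : forall i A, lev i A -> lev (S i) A;
  Univ : nat -> Ty;
  lev_Univ : forall i, lev (S i) (Univ i);
  code : forall i A, lev i A -> El (Univ i);
  dec : forall i, El (Univ i) -> Ty;
  lev_dec : forall i (X : El (Univ i)), lev i (dec X);
  dec_code : forall i A (h : lev i A), dec (code h) = A;
  code_dec : forall i (X : El (Univ i)) (h : lev i (dec X)), code h = X;

  Pi : forall A : Ty, (El A -> Ty) -> Ty;
  lam : forall A (B : El A -> Ty), (forall a, El (B a)) -> El (Pi B);
  app : forall A (B : El A -> Ty), El (Pi B) -> forall a, El (B a);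
  app_lam : forall A (B : El A -> Ty) (f : forall a, El (B a)) a,
    app (lam f) a = f a;
  lam_app : forall A (B : El A -> Ty) (f : El (Pi B)), lam (app f) = f;
  lev_Pi : forall i A (B : El A -> Ty),
    lev i A -> (forall a, lev i (B a)) -> lev i (Pi B);

  Sig : forall A : Ty, (El A -> Ty) -> Ty;
  pair : forall A (B : El A -> Ty) (a : El A), El (B a) -> El (Sig B);
  Sig_ind : forall A (B : El A -> Ty) (C : El (Sig B) -> Ty),
    (forall a (b : El (B a)), El (C (pair b))) -> forall s, El (C s);
  Sig_ind_pair : forall A (B : El A -> Ty) (C : El (Sig B) -> Ty)
    (d : forall a (b : El (B a)), El (C (pair b))) a (b : El (B a)),
    Sig_ind d (pair b) = d a b;
  lev_Sig : forall i A (B : El A -> Ty),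
    lev i A -> (forall a, lev i (B a)) -> lev i (Sig B);

  Empty : Ty;
  Empty_ind : forall C : El Empty -> Ty, forall e, El (C e);
  lev_Empty : lev 0 Empty;

  Unit : Ty;
  star : El Unit;
  Unit_ind : forall C : El Unit -> Ty, El (C star) -> forall t, El (C t);
  Unit_ind_star : forall (C : El Unit -> Ty) (d : El (C star)),
    Unit_ind d star = d;
  lev_Unit : lev 0 Unit;

  Sum : Ty -> Ty -> Ty;
  inl : forall A B, El A -> El (Sum A B);
  inr : forall A B, El B -> El (Sum A B);
  Sum_ind : forall A B (C : El (Sum A B) -> Ty),
    (forall a, El (C (inl B a))) -> (forall b, El (C (inr A b))) ->
    forall s, El (C s);
  Sum_ind_inl : forall A B (C : El (Sum A B) -> Ty)
    (d : forall a, El (C (inl B a))) (e : forall b, El (C (inr A b))) a,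
    Sum_ind d e (inl B a) = d a;
  Sum_ind_inr : forall A B (C : El (Sum A B) -> Ty)
    (d : forall a, El (C (inl B a))) (e : forall b, El (C (inr A b))) b,
    Sum_ind d e (inr A b) = e b;
  lev_Sum : forall i A B, lev i A -> lev i B -> lev i (Sum A B);

  Nat : Ty;
  zero : El Nat;
  succ : El Nat -> El Nat;
  Nat_ind : forall C : El Nat -> Ty,
    El (C zero) -> (forall n, El (C n) -> El (C (succ n))) ->
    forall n, El (C n);
  Nat_ind_zero : forall (C : El Nat -> Ty) (d : El (C zero))
    (e : forall n, El (C n) -> El (C (succ n))), Nat_ind d e zero = d;
  Nat_ind_succ : forall (C : El Nat -> Ty) (d : El (C zero))
    (e : forall n, El (C n) -> El (C (succ n))) n,
    Nat_ind d e (succ n) = e n (Nat_ind d e n);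
  lev_Nat : lev 0 Nat;

  Id : forall A : Ty, El A -> El A -> Ty;
  refl : forall A (x : El A), El (Id x x);
  J : forall A (x : El A) (C : forall y, El (Id x y) -> Ty),
    El (C x (refl x)) -> forall y p, El (C y p);
  J_refl : forall A (x : El A) (C : forall y, El (Id x y) -> Ty)
    (d : El (C x (refl x))), J d (refl x) = d;
  lev_Id : forall i A (x y : El A), lev i A -> lev i (Id x y)
}.

Coercion El : Ty >-> Sortclass.
Arguments code {_} i A h.
Arguments Pi {_} A B.
Arguments Sig {_} A B.
Arguments pair {_ A B} a b.
Arguments Sig_ind_pair {_ A B C} d a b.
Arguments refl {_ A} x.
Arguments inl {_ A} B a.
Arguments inr {_} A {B} b.

Declare Scope hott_scope.
Delimit Scope hott_scope with hott.
Open Scope hott_scope.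

Notation "f @@ a" := (app f a) (at level 10, left associativity) : hott_scope.
Notation "'Π' x : A , B" := (Pi A (fun x => B))
  (at level 200, x name, A at level 200, B at level 200, right associativity)
  : hott_scope.
Notation "'Σ' x : A , B" := (Sig A (fun x => B))
  (at level 200, x name, A at level 200, B at level 200, right associativity)
  : hott_scope.
Notation "A ⇒ B" := (Pi A (fun _ => B))
  (at level 99, right associativity) : hott_scope.
Notation "A × B" := (Sig A (fun _ => B))
  (at level 80, right associativity) : hott_scope.
Notation "A ⇔ B" := ((A ⇒ B) × (B ⇒ A)) (at level 100) : hott_scope.

Section Basic.
Context {M : MLTT}.

Definition fst {A : Ty} {B : A -> Ty} : Sig A B -> A :=
  Sig_ind (C := fun _ => A) (fun a _ => a).

Lemma fst_pair {A : Ty} {B : A -> Ty} {a : A} (b : B a) : fst (pair a b) = a.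
Proof. exact (Sig_ind_pair (C := fun _ => A) (fun a _ => a) a b). Qed.

Definition snd {A : Ty} {B : A -> Ty} : forall s : Sig A B, B (fst s) :=
  Sig_ind (C := fun s => B (fst s))
    (fun a b => eq_rect_r (fun x => El (B x)) b (fst_pair b)).

Definition transport {A : Ty} (P : A -> Ty) {x y : A} (p : Id x y) (d : P x)
  : P y := J (C := fun y _ => P y) d p.

Global Arguments transport {A} P {x y} p d.

Definition ap {A B : Ty} (f : A -> B) {x y : A} (p : Id x y)
  : Id (f x) (f y) := transport (fun y => Id (f x) (f y)) p (refl (f x)).

Global Arguments ap {A B} f {x y} p.

Definition inv {A : Ty} {x y : A} (p : Id x y) : Id y x :=
  transport (fun y => Id y x) p (refl x).

Definition concat {A : Ty} {x y z : A} (p : Id x y) (q : Id y z) : Id x z :=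
  transport (fun z => Id x z) q p.

Definition isProp (A : Ty) : Ty := Π x : A, Π y : A, Id x y.
Definition isSet (A : Ty) : Ty := Π x : A, Π y : A, isProp (Id x y).
Definition isContr (A : Ty) : Ty := Σ a : A, Π x : A, Id a x.

Definition fiber {A B : Ty} (f : A ⇒ B) (y : B) : Ty := Σ x : A, Id (f @@ x) y.
Definition isEquiv {A B : Ty} (f : A ⇒ B) : Ty := Π y : B, isContr (fiber f y).
Definition Equiv (A B : Ty) : Ty := Σ f : A ⇒ B, isEquiv f.

Definition idmap (A : Ty) : A ⇒ A := lam (fun a => a).

Lemma isEquiv_idmap (A : Ty) : isEquiv (idmap A).
Proof.
apply lam; intro y; unfold fiber, idmap.
replace (fun x : A => Id (lam (fun a : A => a) @@ x) y)
  with (fun x : A => Id x y)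
  by (apply functional_extensionality; intro x; now rewrite app_lam).
refine (pair (pair (B := fun x : A => Id x y) y (refl y)) _).
apply lam; apply Sig_ind; intros x p.
apply (J (C := fun z q => Id (pair (B := fun x : A => Id x z) z (refl z))
                             (pair (B := fun x : A => Id x z) x q)) (refl _) p).
Defined.

Definition idtoeqv {i : nat} (X Y : Univ i) : Id X Y ⇒ Equiv (dec X) (dec Y) :=
  lam (fun p => transport (fun Z => Equiv (dec X) (dec Z)) p
                  (pair (idmap (dec X)) (isEquiv_idmap (dec X)))).

End Basic.

Class HoTT (M : MLTT) := {
  univalence : forall i (X Y : Univ i), isEquiv (idtoeqv X Y);

  Tr : Ty -> Ty;
  tr : forall A : Ty, A -> Tr A;
  Tr_isProp : forall A : Ty, isProp (Tr A);
  Tr_ind : forall (A : Ty) (C : Tr A -> Ty),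
    (forall t, isProp (C t)) -> (forall a, C (tr a)) -> forall t, C t;
  Tr_ind_tr : forall (A : Ty) (C : Tr A -> Ty) (h : forall t, isProp (C t))
    (d : forall a, C (tr a)) a, Tr_ind h d (tr a) = d a;
  lev_Tr : forall i A, lev i A -> lev i (Tr A)
}.

Notation "'∃' x : A , B" := (Tr (Sig A (fun x => B)))
  (at level 200, x name, A at level 200, B at level 200, right associativity)
  : hott_scope.
Notation "A ∨ B" := (Tr (Sum A B)) (at level 85, right associativity)
  : hott_scope.

Section HProps.
Context {M : MLTT} {H : HoTT M}.

Lemma is_prop (A : Ty) : (forall x y : A, Id x y) -> isProp A.
Proof. intro h; exact (lam (fun x => lam (fun y => h x y))). Qed.

Lemma prop_eq (A : Ty) (h : isProp A) (x y : A) : Id x y.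
Proof. exact (h @@ x @@ y). Qed.

Lemma isProp_singleton (A : Ty) (a : A) : isProp (Σ x : A, Id a x).
Proof.
assert (h : forall s : Sig A (fun x => Id a x), Id (pair a (refl a)) s).
{ apply Sig_ind; intros x p.
  exact (J (C := fun z q => Id (pair a (refl a)) (pair z q)) (refl _) p). }
apply is_prop; intros x y; exact (concat (inv (h x)) (h y)).
Qed.

(* Tr (Unit + Unit) is an interval, whence function extensionality. *)
Lemma funext (A : Ty) (B : A -> Ty) (f g : Pi A B) :
  (forall a, Id (f @@ a) (g @@ a)) -> Id f g.
Proof.
intro h.
set (k := fun a => Tr_ind (C := fun _ => Σ y : B a, Id (f @@ a) y)
  (fun _ => isProp_singleton (f @@ a))
  (Sum_ind (C := fun _ : Sum Unit Unit => Σ y : B a, Id (f @@ a) y)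
     (fun _ => pair (f @@ a) (refl _)) (fun _ => pair (g @@ a) (h a)))).
set (K := fun t => lam (fun a => fst (k a t))).
assert (Kf : K (tr (inl Unit star)) = f).
{ rewrite <- (lam_app f); unfold K; f_equal.
  apply functional_extensionality_dep; intro a; unfold k.
  now rewrite Tr_ind_tr, Sum_ind_inl, fst_pair. }
assert (Kg : K (tr (inr Unit star)) = g).
{ rewrite <- (lam_app g); unfold K; f_equal.
  apply functional_extensionality_dep; intro a; unfold k.
  now rewrite Tr_ind_tr, Sum_ind_inr, fst_pair. }
rewrite <- Kf, <- Kg.
apply (ap K); apply prop_eq; apply Tr_isProp.
Qed.

Lemma isProp_Pi (A : Ty) (B : A -> Ty) :
  (forall a, isProp (B a)) -> isProp (Pi A B).
Proof.
intro h; apply is_prop; intros f g; apply funext; intro a.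
now apply prop_eq.
Qed.

Lemma path_pair (A : Ty) (B : A -> Ty) (h : forall a, isProp (B a))
  (a a' : A) (p : Id a a') (b : B a) (b' : B a') : Id (pair a b) (pair a' b').
Proof.
revert b'.
enough (c : Π b' : B a', Id (pair a b) (pair a' b')) by (intro; exact (c @@ b')).
apply (transport (fun x => Π b' : B x, Id (pair a b) (pair x b')) p).
apply lam; intro b'; apply (ap (fun z => pair a z)); now apply prop_eq.
Qed.

Lemma isProp_Sig (A : Ty) (B : A -> Ty) :
  isProp A -> (forall a, isProp (B a)) -> isProp (Sig A B).
Proof.
intros hA hB; apply is_prop.
intros x y; revert x.
apply Sig_ind; intros a b; revert y; apply Sig_ind; intros a' b'.
apply path_pair; trivial; now apply prop_eq.
Qed.

Lemma isProp_Empty : isProp Empty.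
Proof.
apply is_prop; intros x y; exact (Empty_ind (fun e => Id e y) x).
Qed.

Lemma concat_inv (A : Ty) (x y : A) (p : Id x y) :
  Id (concat (inv p) p) (refl y).
Proof.
apply (J (C := fun y p => Id (concat (inv p) p) (refl y))).
unfold concat, inv, transport; rewrite !J_refl; apply refl.
Qed.

Lemma isSet_of_rel (A : Ty) (R : A -> A -> Ty) :
  (forall x y, isProp (R x y)) -> (forall x, R x x) ->
  (forall x y, R x y -> Id x y) -> isSet A.
Proof.
intros Rprop Rrefl Rid; apply lam; intro x; apply lam; intro y.
set (g := fun z (p : Id x z) => Rid x z (transport (R x) p (Rrefl x))).
assert (e : forall p : Id x y, Id (concat (inv (g x (refl x))) (g y p)) p).
{ intro p.
  apply (J (C := fun z p => Id (concat (inv (g x (refl x))) (g z p)) p)).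
  apply concat_inv. }
apply is_prop; intros p q.
apply (concat (inv (e p))); refine (concat _ (e q)).
apply (ap (fun r => concat (inv (g x (refl x))) r)).
unfold g; apply (ap (Rid x y)); now apply prop_eq.
Qed.

Lemma isSet_isProp (A : Ty) : isProp A -> isSet A.
Proof.
intro h; apply (isSet_of_rel (R := fun _ _ => Unit)).
- intros _ _; apply is_prop; intros x y; refine (Unit_ind (C := fun x => Id x y) _ x).
  exact (Unit_ind (C := fun y => Id star y) (refl star) y).
- intro; exact star.
- intros x y _; now apply prop_eq.
Qed.

Lemma isProp_isProp (A : Ty) : isProp (isProp A).
Proof.
apply is_prop; intros f g; apply funext; intro x; apply funext; intro y.
exact (prop_eq (isSet_isProp f @@ x @@ y) _ _).
Qed.

Lemma propext (i : nat) (X Y : Univ i) :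
  isProp (dec X) -> isProp (dec Y) ->
  (dec X -> dec Y) -> (dec Y -> dec X) -> Id X Y.
Proof.
intros hX hY f g.
assert (e : isEquiv (lam f)).
{ apply lam; intro y.
  refine (pair (pair (B := fun x => Id (lam f @@ x) y) (g y)
                     (prop_eq hY _ _)) _).
  apply lam; intro s; apply prop_eq; apply isProp_Sig; trivial.
  intro x; exact (isSet_isProp hY @@ _ @@ _). }
exact (fst (fst (univalence X Y @@ (pair (lam f) e)))).
Qed.

Definition hProp (i : nat) : Ty := Σ P : Univ i, isProp (dec P).

Definition mkProp {i : nat} (A : Ty) (hl : lev i A) (hp : isProp A) : hProp i :=
  pair (B := fun P => isProp (dec P)) (code i A hl)
    (eq_rect_r (fun B => El (isProp B)) hp (dec_code hl)).

Definition holds {i : nat} (P : hProp i) : Ty := dec (fst P).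

Lemma holds_mkProp (i : nat) (A : Ty) (hl : lev i A) (hp : isProp A) :
  holds (mkProp hl hp) = A.
Proof. unfold holds, mkProp; rewrite fst_pair; apply dec_code. Qed.

Lemma lev_holds (i : nat) (P : hProp i) : lev i (holds P).
Proof. apply lev_dec. Qed.

Lemma isProp_holds (i : nat) (P : hProp i) : isProp (holds P).
Proof. exact (snd P). Qed.

Lemma hProp_eq (i : nat) (P Q : hProp i) :
  (holds P -> holds Q) -> (holds Q -> holds P) -> Id P Q.
Proof.
intros f g.
enough (c : Π Q : hProp i, (holds P ⇒ holds Q) ⇒ (holds Q ⇒ holds P) ⇒ Id P Q)
  by exact (c @@ Q @@ (lam f) @@ (lam g)).
clear f g Q; revert P; apply Sig_ind; intros X hX.
apply lam; apply Sig_ind; intros Y hY.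
apply lam; intro f; apply lam; intro g.
apply path_pair; [intro; apply isProp_isProp |].
unfold holds in f, g; rewrite !fst_pair in f, g.
exact (propext hX hY (app f) (app g)).
Qed.

Lemma isSet_hProp (i : nat) : isSet (hProp i).
Proof.
apply (isSet_of_rel (R := fun P Q : hProp i => holds P ⇔ holds Q)).
- intros P Q; apply isProp_Sig; intros; apply isProp_Pi; intros;
    apply isProp_holds.
- intro P; exact (pair (lam (fun x => x)) (lam (fun x => x))).
- intros P Q; apply Sig_ind; intros f g; exact (hProp_eq (app f) (app g)).
Qed.

Lemma transport_const (A B : Ty) (x y : A) (p : Id x y) (b : B) :
  Id (transport (fun _ => B) p b) b.
Proof.
apply (J (C := fun y p => Id (transport (fun _ => B) p b) b)).
unfold transport; rewrite J_refl; apply refl.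
Qed.

Lemma lev_le (i j : nat) (A : Ty) : i <= j -> lev i A -> lev j A.
Proof. intros h hA; induction h; auto using lev_cumul. Qed.

End HProps.

Section Bisim.
Context {M : MLTT} {H : HoTT M}.

Definition eqimage {A B V : Ty} (f : A ⇒ V) (g : B ⇒ V) : Ty :=
  (Π a : A, ∃ b : B, Id (f @@ a) (g @@ b)) ×
  (Π b : B, ∃ a : A, Id (f @@ a) (g @@ b)).

(* The dependent version of [eqimage], over elements h, k of P above f, g. *)
Definition eqimage_over {A B V : Ty} (f : A ⇒ V) (g : B ⇒ V) (P : V -> Ty)
  (h : Π a : A, P (f @@ a)) (k : Π b : B, P (g @@ b)) : Ty :=
  (Π a : A, ∃ b : B, Σ p : Id (f @@ a) (g @@ b),
     Id (transport P p (h @@ a)) (k @@ b)) ×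
  (Π b : B, ∃ a : A, Σ p : Id (f @@ a) (g @@ b),
     Id (transport P p (h @@ a)) (k @@ b)).

Global Arguments eqimage_over {A B V f g} P h k.

End Bisim.

(* The higher inductive type V : U_u' of sets built from types in U_u.  As its
   last constructor makes V a set, the motives of the induction principle are
   families of sets, for which the path constructors need no computation
   rule. *)
Class CumulativeHierarchy (M : MLTT) (H : HoTT M) (u u' : nat) := {
  V : Ty;
  lev_V : lev u' V;
  set : forall A : Univ u, (dec A ⇒ V) -> V;
  set_eq : forall (A B : Univ u) (f : dec A ⇒ V) (g : dec B ⇒ V),
    eqimage f g -> Id (set f) (set g);
  V_isSet : isSet V;
  V_ind : forall P : V -> Ty, (forall x, isSet (P x)) ->
    forall s : forall (A : Univ u) (f : dec A ⇒ V),
      (Π a : dec A, P (f @@ a)) -> P (set f),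
    (forall (A B : Univ u) (f : dec A ⇒ V) (g : dec B ⇒ V)
       (e : eqimage f g)
       (h : Π a : dec A, P (f @@ a)) (k : Π b : dec B, P (g @@ b)),
       eqimage_over P h k ->
       Id (transport P (set_eq e) (s A f h)) (s B g k)) ->
    forall x, P x;
  V_ind_set : forall (P : V -> Ty) (hP : forall x, isSet (P x))
    (s : forall (A : Univ u) (f : dec A ⇒ V),
      (Π a : dec A, P (f @@ a)) -> P (set f))
    (q : forall (A B : Univ u) (f : dec A ⇒ V) (g : dec B ⇒ V)
       (e : eqimage f g)
       (h : Π a : dec A, P (f @@ a)) (k : Π b : dec B, P (g @@ b)),
       eqimage_over P h k ->
       Id (transport P (set_eq e) (s A f h)) (s B g k))
    (A : Univ u) (f : dec A ⇒ V),
    V_ind hP q (set f) = s A f (lam (fun a => V_ind hP q (f @@ a)))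
}.

Inductive formula (n : nat) : Type :=
| fEq (i j : Fin.t n)
| fIn (i j : Fin.t n)
| fNot (a : formula n)
| fImp (a b : formula n)
| fAnd (a b : formula n)
| fOr (a b : formula n)
| fEx (a : formula (S n))
| fAll (a : formula (S n)).

Definition scons {X : Type} {n : nat} (x : X) (r : Fin.t n -> X)
  : Fin.t (S n) -> X := fun i => Fin.caseS' i (fun _ => X) x r.

Definition snil {X : Type} : Fin.t 0 -> X := Fin.case0 (fun _ => X).

Definition up {n m : nat} (r : Fin.t n -> Fin.t m) : Fin.t (S n) -> Fin.t (S m) :=
  scons F1 (fun i => FS (r i)).

Fixpoint rename {n m : nat} (r : Fin.t n -> Fin.t m) (a : formula n)
  : formula m :=
  match a with
  | fEq i j => fEq (r i) (r j)
  | fIn i j => fIn (r i) (r j)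
  | fNot a => fNot (rename r a)
  | fImp a b => fImp (rename r a) (rename r b)
  | fAnd a b => fAnd (rename r a) (rename r b)
  | fOr a b => fOr (rename r a) (rename r b)
  | fEx a => fEx (rename (up r) a)
  | fAll a => fAll (rename (up r) a)
  end.

Definition fIff {n : nat} (a b : formula n) : formula n :=
  fAnd (fImp a b) (fImp b a).

(* ∃!y a(y) is ∃y (a(y) ∧ ∀z (a(z) → z = y)). *)
Definition fExUnique {n : nat} (a : formula (S n)) : formula n :=
  fEx (fAnd a (fAll (fImp (rename (scons F1 (fun i => FS (FS i))) a)
                          (fEq F1 (FS F1))))).

(* a(i, j), for a formula a(x, y) whose variable x is [F1] and y is [FS F1] *)
Definition subst2 {n : nat} (a : formula 2) (i j : Fin.t n) : formula n :=
  rename (scons i (scons j snil)) a.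

(* Variables are de Bruijn indices: x, y are 1, 0 below ∃!y; v, w are 0, 1
   below ∀v; and u, v, S are 0, 1, 3 below ∃u. *)
Definition replacement (a : formula 2) : formula 0 :=
  fAll (fImp
    (fAll (fExUnique (subst2 a (FS F1) F1)))
    (fEx (fAll (fIff
      (fIn F1 (FS F1))
      (fEx (fAnd (fIn F1 (FS (FS (FS F1)))) (subst2 a F1 (FS F1)))))))).

Section Semantics.
Context {M : MLTT} {H : HoTT M} {u u' : nat} (uu' : u < u')
  {VV : CumulativeHierarchy H u u'}.

Lemma lev_small (A : Univ u) : lev u' (dec A).
Proof.
exact (lev_le (PeanoNat.Nat.lt_le_incl _ _ uu') (lev_dec A)).
Qed.

Definition mem_step (x : V) (A : Univ u) (f : dec A ⇒ V) : hProp u' :=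
  mkProp (A := ∃ a : dec A, Id x (f @@ a))
    (lev_Tr (lev_Sig (lev_small A) (fun a => lev_Id _ _ lev_V)))
    (Tr_isProp _).

Lemma mem_step_sub (x : V) (A B : Univ u) (f : dec A ⇒ V) (g : dec B ⇒ V) :
  (Π a : dec A, ∃ b : dec B, Id (f @@ a) (g @@ b)) ->
  holds (mem_step x f) -> holds (mem_step x g).
Proof.
intro e; unfold mem_step; rewrite !holds_mkProp.
refine (Tr_ind (C := fun _ => _) (fun _ => Tr_isProp _) _).
refine (Sig_ind (C := fun _ => _) _); intros a p.
refine (Tr_ind (C := fun _ => _) (fun _ => Tr_isProp _) _ (e @@ a)).
refine (Sig_ind (C := fun _ => _) _); intros b q.
exact (tr (pair (B := fun b => Id x (g @@ b)) b (concat p q))).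
Qed.

Lemma mem_step_eq (x : V) (A B : Univ u) (f : dec A ⇒ V) (g : dec B ⇒ V)
  (e : eqimage f g) :
  Id (transport (fun _ => hProp u') (set_eq e) (mem_step x f)) (mem_step x g).
Proof.
apply (concat (transport_const _ _)).
apply hProp_eq; apply mem_step_sub; [exact (fst e) |].
apply lam; intro b.
refine (Tr_ind (C := fun _ => _) (fun _ => Tr_isProp _) _ (snd e @@ b)).
refine (Sig_ind (C := fun _ => _) _); intros a p.
exact (tr (pair (B := fun a => Id (g @@ b) (f @@ a)) a (inv p))).
Qed.

Definition mem (x y : V) : hProp u' :=
  V_ind (P := fun _ => hProp u') (fun _ => isSet_hProp u')
    (s := fun A f _ => mem_step x f)
    (fun A B f g e _ _ _ => mem_step_eq x e) y.

Lemma holds_mem_set (x : V) (A : Univ u) (f : dec A ⇒ V) :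
  holds (mem x (set f)) = ∃ a : dec A, Id x (f @@ a).
Proof. unfold mem; rewrite V_ind_set; apply holds_mkProp. Qed.

Definition pEq (x y : V) : hProp u' :=
  mkProp (lev_Id x y lev_V) (V_isSet @@ x @@ y).

Definition pImp (P Q : hProp u') : hProp u' :=
  mkProp (lev_Pi (lev_holds P) (fun _ => lev_holds Q))
    (isProp_Pi (fun _ => isProp_holds Q)).

Definition pNot (P : hProp u') : hProp u' :=
  mkProp (A := holds P ⇒ Empty)
    (lev_Pi (lev_holds P) (fun _ => lev_le (le_0_n u') lev_Empty))
    (isProp_Pi (fun _ => isProp_Empty)).

Definition pAnd (P Q : hProp u') : hProp u' :=
  mkProp (lev_Sig (lev_holds P) (fun _ => lev_holds Q))
    (isProp_Sig (isProp_holds P) (fun _ => isProp_holds Q)).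

Definition pOr (P Q : hProp u') : hProp u' :=
  mkProp (lev_Tr (lev_Sum (lev_holds P) (lev_holds Q))) (Tr_isProp _).

Definition pEx (P : V -> hProp u') : hProp u' :=
  mkProp (lev_Tr (lev_Sig lev_V (fun x => lev_holds (P x)))) (Tr_isProp _).

Definition pAll (P : V -> hProp u') : hProp u' :=
  mkProp (lev_Pi lev_V (fun x => lev_holds (P x)))
    (isProp_Pi (fun x => isProp_holds (P x))).

Fixpoint sem {n : nat} (a : formula n) (r : Fin.t n -> V) : hProp u' :=
  match a with
  | fEq i j => pEq (r i) (r j)
  | fIn i j => mem (r i) (r j)
  | fNot a => pNot (sem a r)
  | fImp a b => pImp (sem a r) (sem b r)
  | fAnd a b => pAnd (sem a r) (sem b r)
  | fOr a b => pOr (sem a r) (sem b r)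
  | fEx a => pEx (fun x => sem a (scons x r))
  | fAll a => pAll (fun x => sem a (scons x r))
  end.

Definition HReplacement : Ty :=
  Π r : V ⇒ V, Π x : V, ∃ w : V, Π y : V,
    (holds (mem y w) ⇔ ∃ z : V, holds (mem z x) × Id y (r @@ z)).

End Semantics.

(* Main.v *)
From Stdlib Require Import FunctionalExtensionality.
Require Import Defs.

(** A class function defined by a formula is only given by the mere existence,
for each x, of a unique y; H-Replacement asks for an actual function V -> V.
The gap is closed by unique choice ([unique_choice]): since V is a set, the
type of the y that satisfy a propositional predicate P and to which every
solution of P is equal is a proposition, so the truncation in front of it can
be eliminated and a witness extracted.  Doing this for every x yields
r : V -> V with phi(x, r(x)), and uniqueness makes phi(x, y) equivalent to
y = r(x); the set w that H-Replacement provides for this r is then the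
one that the Replacement scheme asks for ([replacement_of_relation]).

It remains to see that the de Bruijn formula [replacement phi] means the
Replacement statement for the relation that phi defines
([holds_replacement]).  This rests on the fact that renaming variables
amounts to precomposing the environment ([sem_rename]). *)

Section Choice.
Set Implicit Arguments.
Unset Strict Implicit.
Context {M : MLTT} {H : HoTT M}.

Lemma Tr_elim (A C : Ty) : isProp C -> (A -> C) -> Tr A -> C.
Proof. intros hC f; exact (Tr_ind (C := fun _ => C) (fun _ => hC) f). Qed.

Definition uniquely {A : Ty} (P : A -> Ty) (y : A) : Ty :=
  P y × Π z : A, P z ⇒ Id z y.

(** Two solutions that are both unique are equal by the uniqueness of either;
over such a path the remaining data agree because, [A] being a set, they are
propositional. *)
Lemma isProp_uniquely (A : Ty) (P : A -> Ty) :
  isSet A -> (forall y, isProp (P y)) -> isProp (Sig A (uniquely P)).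
Proof.
intros hA hP; apply is_prop; intros s t.
revert s; apply Sig_ind; intros y p; revert t; apply Sig_ind; intros z q.
apply path_pair.
- intro a; apply isProp_Sig; [apply hP |]; intros _.
  apply isProp_Pi; intro b; apply isProp_Pi; intros _.
  exact (hA @@ b @@ a).
- exact (snd q @@ y @@ (fst p)).
Qed.

Lemma unique_choice (A : Ty) (P : A -> Ty) :
  isSet A -> (forall y, isProp (P y)) ->
  (∃ y : A, uniquely P y) -> Sig A (uniquely P).
Proof. intros hA hP; apply Tr_elim; [now apply isProp_uniquely | trivial]. Qed.

End Choice.

Section Replacement.
Set Implicit Arguments.
Unset Strict Implicit.
Context {M : MLTT} {H : HoTT M} {u u' : nat} (uu' : u < u')
  {VV : CumulativeHierarchy H u u'}.

Lemma scons_comp {X Y : Type} {n : nat} (f : X -> Y) (x : X)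
  (r : Fin.t n -> X) : (fun i => f (scons x r i)) = scons (f x) (fun i => f (r i)).
Proof.
apply functional_extensionality; intro i.
now apply (Fin.caseS' i).
Qed.

Lemma snil_unique {X : Type} (r : Fin.t 0 -> X) : r = snil.
Proof. apply functional_extensionality; intro i; exact (Fin.case0 (fun i => r i = snil i) i). Qed.

Lemma sem_rename {n m : nat} (a : formula n) (s : Fin.t n -> Fin.t m)
  (r : Fin.t m -> V) :
  sem uu' (rename s a) r = sem uu' a (fun i => r (s i)).
Proof.
assert (e : forall n m (s : Fin.t n -> Fin.t m) (r : Fin.t m -> V) x,
  (fun i => scons x r (up s i)) = scons x (fun i => r (s i))).
{ intros; apply (scons_comp (scons x r0)). }
revert m s r; induction a; intros m s r; cbn; trivial;
  rewrite ?IHa, ?IHa1, ?IHa2; trivial;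
  f_equal; apply functional_extensionality; intro x; now rewrite IHa, e.
Qed.

Definition relation (phi : formula 2) (x y : V) : hProp u' :=
  sem uu' phi (scons x (scons y snil)).

Lemma sem_subst2 {n : nat} (phi : formula 2) (i j : Fin.t n) (r : Fin.t n -> V) :
  sem uu' (subst2 phi i j) r = relation phi (r i) (r j).
Proof.
unfold subst2, relation; rewrite sem_rename.
now rewrite !scons_comp, (snil_unique (fun _ => _)).
Qed.

Lemma holds_pImp (P Q : hProp u') : holds (pImp P Q) = (holds P ⇒ holds Q).
Proof. apply holds_mkProp. Qed.

Lemma holds_pAnd (P Q : hProp u') : holds (pAnd P Q) = (holds P × holds Q).
Proof. apply holds_mkProp. Qed.

Lemma holds_pEq (x y : V) : holds (pEq x y) = Id x y.
Proof. apply holds_mkProp. Qed.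

Lemma holds_pEx (P : V -> hProp u') (B : V -> Ty) :
  (forall x, holds (P x) = B x) -> holds (pEx P) = ∃ x : V, B x.
Proof.
intro e; rewrite <- (functional_extensionality _ _ e); apply holds_mkProp.
Qed.

Lemma holds_pAll (P : V -> hProp u') (B : V -> Ty) :
  (forall x, holds (P x) = B x) -> holds (pAll P) = Π x : V, B x.
Proof.
intro e; rewrite <- (functional_extensionality _ _ e); apply holds_mkProp.
Qed.

Lemma holds_fExUnique {n : nat} (a : formula (S n)) (r : Fin.t n -> V) :
  holds (sem uu' (fExUnique a) r)
  = ∃ y : V, uniquely (fun y => holds (sem uu' a (scons y r))) y.
Proof.
apply holds_pEx; intro y; cbn [sem]; rewrite holds_pAnd; unfold uniquely.
f_equal; apply functional_extensionality; intros _.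
apply holds_pAll; intro z; cbn [sem]; rewrite holds_pImp, holds_pEq.
now rewrite sem_rename, (scons_comp (scons z (scons y r))).
Qed.

(** Each connective is interpreted by [mkProp] of the corresponding type, whose
decoding gives that type back judgmentally; hence the two sides are equal and
not merely equivalent, and rewriting is possible under the binders. *)
Lemma holds_replacement (phi : formula 2) :
  holds (sem uu' (replacement phi) snil)
  = Π S : V,
      (Π x : V, ∃ y : V, uniquely (fun y => holds (relation phi x y)) y) ⇒
      ∃ w : V, Π v : V, (holds (mem uu' v w) ⇔
        ∃ z : V, holds (mem uu' z S) × holds (relation phi z v)).
Proof.
apply holds_pAll; intro S; cbn [sem]; rewrite holds_pImp.
rewrite (holds_pAll (B := fun x =>
  ∃ y : V, uniquely (fun y => holds (relation phi x y)) y)).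
- f_equal; apply functional_extensionality; intros _.
  apply holds_pEx; intro w; cbn [sem]; apply holds_pAll; intro v.
  unfold fIff; cbn [sem]; rewrite holds_pAnd, !holds_pImp.
  rewrite (holds_pEx (B := fun z =>
    holds (mem uu' z S) × holds (relation phi z v))); [reflexivity |].
  intro z; cbn [sem]; now rewrite holds_pAnd, sem_subst2.
- intro x; rewrite holds_fExUnique.
  assert (e : (fun y => holds (sem uu' (subst2 phi (Fin.FS Fin.F1) Fin.F1)
                (scons y (scons x (scons S snil)))))
    = (fun y => holds (relation phi x y))).
  { apply functional_extensionality; intro y; now rewrite sem_subst2. }
  now rewrite e.
Qed.

(** Unique choice for each x makes [R] the graph of a function, to which
H-Replacement applies; a merely existing y would not give one. *)
Lemma replacement_of_relation (R : V -> V -> hProp u') :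
  HReplacement uu' ->
  (forall x : V, ∃ y : V, uniquely (fun y => holds (R x y)) y) ->
  forall S : V, ∃ w : V, Π v : V, (holds (mem uu' v w) ⇔
    ∃ z : V, holds (mem uu' z S) × holds (R z v)).
Proof.
intros hrep hR S.
set (c := fun x => unique_choice V_isSet (fun y => isProp_holds (R x y)) (hR x)).
set (r := lam (fun x => fst (c x))).
assert (to : forall z v, Id v (r @@ z) -> holds (R z v)).
{ intros z v p; apply (transport (fun y => holds (R z y)) (inv p)).
  unfold r; rewrite app_lam; exact (fst (snd (c z))). }
assert (from : forall z v, holds (R z v) -> Id v (r @@ z)).
{ intros z v; unfold r; rewrite app_lam; exact (app (snd (snd (c z)) @@ v)). }
generalize (hrep @@ r @@ S); apply Tr_elim; [apply Tr_isProp |].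
apply Sig_ind; intros w hw; apply tr; refine (pair w _).
apply lam; intro v; refine (pair (lam _) (lam _)).
- intro m; generalize (fst (hw @@ v) @@ m).
  apply Tr_elim; [apply Tr_isProp |]; apply Sig_ind; intros z s.
  exact (tr (pair (B := fun z => holds (mem uu' z S) × holds (R z v)) z
               (pair (fst s) (to z v (snd s))))).
- intro t; apply (app (snd (hw @@ v))); revert t.
  apply Tr_elim; [apply Tr_isProp |]; apply Sig_ind; intros z s.
  exact (tr (pair (B := fun z => holds (mem uu' z S) × Id v (r @@ z)) z
               (pair (fst s) (from z v (snd s))))).
Qed.

End Replacement.

Theorem proposition2 (M : MLTT) (H : HoTT M) (u u' : nat) (uu' : u < u')
  (VV : CumulativeHierarchy H u u') (phi : formula 2) :
  HReplacement uu' ⇒ holds (sem uu' (replacement phi) snil).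
Proof.
apply lam; intro hrep; rewrite holds_replacement.
apply lam; intro S; apply lam; intro hphi.
exact (replacement_of_relation hrep (app hphi) S).
Qed.
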